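(* For integers $n>m\ge 0$ let $Z_{n,m}$ denote the maximal possible number of zeros in $\mathbb{C}$ of a harmonic polynomial $h(z)=p_n(z)+\overline{q_m(z)}$ with $p_n,q_m$ complex polynomials of degrees $n$ and $m$ respectively. Then: (1) for every fixed integer $a\ge 1$, $$\limsup_{n\to\infty}\frac{Z_{n,n-a}}{n^2}=1;$$ (2) more generally, if $m=m(n)$ is a sequence of integers with $0\le m(n)<n$ and $m(n)=\alpha n+o(n)$ as $n\to\infty$ for some $0\le\alpha\le 1$, then $$\limsup_{n\to\infty}\frac{Z_{n,m(n)}}{n^2}\ge\alpha^2.$$
   Context: Zeros are counted as distinct points of $\mathbb{C}$. For $n>m$ every such $h$ has at most $n^2$ zeros (Wilmshurst's theorem), so $Z_{n,m}$ is a well-defined finite number. *)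

(* Defs.v *)
From mathcomp Require Import all_boot all_order all_algebra.
From mathcomp Require Import all_classical all_reals all_analysis.
From mathcomp Require Export complex.
Set Implicit Arguments. Unset Strict Implicit. Unset Printing Implicit Defensive.
Import Order.TTheory GRing.Theory Num.Theory.
Import numFieldNormedType.Exports.
Local Open Scope classical_set_scope.
Local Open Scope card_scope.
Local Open Scope ring_scope.

Definition harmonic_poly (R : realType) (p q : {poly R[i]}) (z : R[i]) : R[i] :=
  p.[z] + (q.[z])^*.

Definition harmonic_zeros (R : realType) (p q : {poly R[i]}) : set R[i] :=
  [set z | harmonic_poly p q z = 0].

(* [size p = n.+1] says that p has degree exactly n; in particular a
   polynomial of degree 0 is a nonzero constant. *)
Definition is_max_zeros (R : realType) (n m N : nat) : Prop :=
  (exists p q : {poly R[i]}, [/\ size p = n.+1, size q = m.+1 &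
     harmonic_zeros p q #= `I_N]) /\
  (forall p q : {poly R[i]}, size p = n.+1 -> size q = m.+1 ->
     harmonic_zeros p q #<= `I_N).

(* At most one N satisfies [is_max_zeros R n m N], and one does when m < n;
   the value is 0 when there is none, which matters only for n <= m. *)
Definition max_zeros (R : realType) (n m : nat) : nat :=
  xget 0%N [set N | is_max_zeros R n m N].

(* Main.v *)
(* Upper bound: at a zero z of h, the equations h(z) = 0 and conj h(z) = 0
   express z^n and conj(z)^n through monomials z^i conj(z)^j of smaller total
   degree, since m < n.  Hence on any N zeros every function is a combination
   of the n^2 monomials with i, j < n, and interpolation gives N <= n^2.

   Lower bound: take p = z^n + Q and q = Q with Q = K c (z - 1)^m.  On each of
   the lines through 0 of direction w = exp(i k pi / n), 0 < k < n, the
   function h is real, equal to +-t^n + 2 K Re (c (t w - 1)^m) at z = t w.  The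
   point of this line where t w - 1 = s w exp(i j pi / m) with s > 0
   contributes (-1)^j s^m Re (c w^m) to the second term, so for c generic and K
   large the signs alternate along the line, and the intermediate value theorem
   gives m - 2 zeros on each of the n - 1 lines.  Zeros on different lines are
   distinct because Re c <> 0 makes h(0) <> 0.  Thus
   (n - 1)(m - 2) <= Z_{n,m} <= n^2, and alpha >= alpha^2. *)
Require Import Defs.
From mathcomp Require Import all_boot all_order all_algebra.
From mathcomp Require Import all_classical all_reals all_analysis.
From mathcomp Require Import polyrcf ring lra zify finmap.
Import Order.TTheory GRing.Theory Num.Theory.
Import numFieldNormedType.Exports.
Local Open Scope classical_set_scope.
Local Open Scope card_scope.
Local Open Scope ring_scope.
Set Implicit Arguments. Unset Strict Implicit. Unset Printing Implicit Defensive.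

(** * Upper bound by linear algebra on monomials *)

Lemma size_common_zeros (F : fieldType) (N n : nat) (x y : 'I_N -> F)
    (a b c d : nat -> F) :
  injective x ->
  (forall k, x k ^+ n = \sum_(l < n) a l * x k ^+ l + \sum_(l < n) b l * y k ^+ l) ->
  (forall k, y k ^+ n = \sum_(l < n) c l * x k ^+ l + \sum_(l < n) d l * y k ^+ l) ->
  (N <= n * n)%N.
Proof.
move=> x_inj xn yn.
pose B : 'M[F]_(n * n, N) := \matrix_(r, k) (x k ^+ (r %/ n) * y k ^+ (r %% n)).
(* Induction on a bound [s] for the total degree: expanding a factor [x k ^+ n] or [y k ^+ n] lowers
   it, since [l < n]. *)
have span : forall s i j, (i + j < s)%N -> ((\row_k (x k ^+ i * y k ^+ j))%R <= B)%MS.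
  elim=> [//|s IHs] i j /[!ltnS] les.
  have [iltn|nlei] := ltnP i n.
    have [jltn|nlej] := ltnP j n.
      have ltr : (i * n + j < n * n)%N by nia.
      rewrite (_ : \row_k _ = row (Ordinal ltr) B) ?row_sub //.
      apply/rowP => k; rewrite !mxE /= divnMDl 1?(leq_ltn_trans _ jltn) //.
      by rewrite modnMDl modn_small // divn_small // addn0.
    rewrite (_ : \row_k _ =
      \sum_(l < n) c l *: (\row_k (x k ^+ (i + l) * y k ^+ (j - n))) +
      \sum_(l < n) d l *: (\row_k (x k ^+ i * y k ^+ (j - n + l)))); last first.
      apply/rowP => k; rewrite !mxE !summxE -{1}(subnK nlej) exprD yn.
      rewrite mulrA mulrDr !mulr_sumr; congr (_ + _);
        by apply: eq_bigr => l _; rewrite !mxE exprD; ring.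
    by apply: addmx_sub; apply: summx_sub => l _; apply: scalemx_sub;
      apply: IHs; have := ltn_ord l; lia.
  rewrite (_ : \row_k _ =
    \sum_(l < n) a l *: (\row_k (x k ^+ (i - n + l) * y k ^+ j)) +
    \sum_(l < n) b l *: (\row_k (x k ^+ (i - n) * y k ^+ (j + l)))); last first.
    apply/rowP => k; rewrite !mxE !summxE -{1}(subnK nlei) exprD xn.
    rewrite mulrAC mulrDr !mulr_sumr; congr (_ + _);
      by apply: eq_bigr => l _; rewrite !mxE exprD; ring.
  by apply: addmx_sub; apply: summx_sub => l _; apply: scalemx_sub;
    apply: IHs; have := ltn_ord l; lia.
(* The Vandermonde rows are the monomials with [j = 0]. Distinct nodes make that matrix invertible,
   so [N] is at most the rank of [B]. *)
have /mxrankS : ((Vandermonde N (\row_k x k))%R <= B)%MS.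
  apply/row_subP => l; rewrite (_ : row l _ = \row_k (x k ^+ l * y k ^+ 0)).
    exact: (span (l + 0).+1).
  by apply/rowP => k; rewrite !mxE mulr1.
rewrite mxrank_unit; first by move=> /leq_trans; apply; exact: rank_leq_row.
rewrite unitmxE det_Vandermonde unitfE; apply/prodf_neq0 => i _.
apply/prodf_neq0 => j ij; rewrite !mxE subr_eq0 (inj_eq x_inj).
by apply: contraTneq ij => ->; rewrite ltnn.
Qed.

Lemma sum_oppr_divr (F : fieldType) (n : nat) (a x : nat -> F) (c : F) :
  \sum_(l < n) - a l / c * x l = - (\sum_(l < n) a l * x l) / c.
Proof.
by rewrite mulNr mulr_suml -sumrN; apply: eq_bigr => l _; ring.
Qed.

Section UpperBound.
Context {R : realType}.
Implicit Types p q : {poly R[i]}.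

(** Dividing h(z) = 0 by the leading coefficient of [p], and the conjugate equation by its
    conjugate, gives the two reductions. Lists of zeros are used because finiteness of the zero set
    is deduced from this bound. *)
Lemma size_harmonic_zeros p q n m (s : seq R[i]) :
  (m < n)%N -> size p = n.+1 -> size q = m.+1 -> uniq s ->
  (forall z, z \in s -> harmonic_zeros p q z) -> (size s <= n ^ 2)%N.
Proof.
move=> mn sp sq us zs; rewrite expnS expn1.
have lp : p`_n != 0 by rewrite -[n]/(n.+1.-1) -sp lead_coef_eq0 -size_poly_gt0 sp.
have pE z : p.[z] = \sum_(l < n) p`_l * z ^+ l + p`_n * z ^+ n.
  by rewrite horner_coef sp big_ord_recr.
have qE z : q.[z] = \sum_(l < n) q`_l * z ^+ l.
  by rewrite (@horner_coef_wide _ n) ?sq.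
have conj_sum (a : nat -> R[i]) z :
    (\sum_(l < n) a l * z ^+ l)^* = \sum_(l < n) (a l)^* * z^* ^+ l.
  by rewrite rmorph_sum; apply: eq_bigr => l _; rewrite rmorphM rmorphXn.
pose f (k : 'I_(size s)) := s`_k.
have fz k : p.[f k] + (q.[f k])^* = 0 by apply: zs; apply: mem_nth.
have lpc : (p`_n)^* != 0 by rewrite fmorph_eq0.
apply: (@size_common_zeros _ _ _ f (fun k => (f k)^*)
  (fun l => - p`_l / p`_n) (fun l => - (q`_l)^* / p`_n)
  (fun l => - q`_l / (p`_n)^*) (fun l => - (p`_l)^* / (p`_n)^*)) => [k k' /eqP|k|k].
- by rewrite nth_uniq // => /eqP/val_inj.
- rewrite (sum_oppr_divr n (nth 0 p) (fun l => f k ^+ l)).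
  rewrite (sum_oppr_divr n (fun l => (q`_l)^*) (fun l => (f k)^* ^+ l)).
  apply: (mulfI lp).
  have := fz k; rewrite pE qE conj_sum => /(canRL (addrK _))/(canRL (addKr _)) ->.
  by field.
- rewrite (sum_oppr_divr n (nth 0 q) (fun l => f k ^+ l)).
  rewrite (sum_oppr_divr n (fun l => (p`_l)^*) (fun l => (f k)^* ^+ l)).
  apply: (mulfI lpc).
  have := congr1 Num.conj (fz k); rewrite rmorphD rmorph0 /= conjCK pE qE.
  rewrite rmorphD /= conj_sum rmorphM rmorphXn /=.
  move=> /(canRL (addrK _))/(canRL (addKr _)) ->.
  by field.
Qed.
End UpperBound.

(** * Trigonometry and real parts on lines through 0 *)

Local Notation Re := complex.Re.
Local Notation Im := complex.Im.

Section Lines.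
Context {R : realType}.
Local Open Scope complex_scope.

Definition cis (x : R) : R[i] := cos x +i* sin x.

Lemma cisX x n : cis x ^+ n = cis (n%:R * x).
Proof.
elim: n => [|n IHn]; first by rewrite mul0r expr0 /cis cos0 sin0.
rewrite exprS IHn -natr1 mulrDl mul1r addrC /cis cosD sinD.
by apply/eqP; rewrite eq_complex /=; apply/andP; split; apply/eqP; ring.
Qed.

Lemma sin_eq0_ltpi (x : R) : sin x = 0 -> `|x| < pi -> x = 0.
Proof.
move=> sx; rewrite ltr_norml => /andP[lt gt]; have [x0|x0|//] := ltgtP x 0.
- have : 0 < sin (- x) by apply: sin_gt0_pi; apply/andP; split; lra.
  by rewrite sinN sx oppr0 ltxx.
- have : 0 < sin x by apply: sin_gt0_pi; apply/andP.
  by rewrite sx ltxx.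
Qed.

(** The difference of the cotangents is sin (y - x) / (sin x sin y). *)
Lemma cot_decr (x y : R) : 0 < x -> x < y -> y < pi ->
  cos y / sin y < cos x / sin x.
Proof.
move=> x0 xy ypi.
have sx : 0 < sin x by apply: sin_gt0_pi; apply/andP; split => //; lra.
have sy : 0 < sin y by apply: sin_gt0_pi; apply/andP; split => //; lra.
have : 0 < sin (y - x) by apply: sin_gt0_pi; apply/andP; split; lra.
rewrite sinB => sxy; rewrite ltr_pdivrMr // mulrAC ltr_pdivlMr //; lra.
Qed.

Lemma frac_pi (n k : nat) : (0 < k < n)%N -> 0 < (k%:R / n%:R * pi : R) < pi.
Proof.
move=> /andP[k0 kn]; have n0 : 0 < n%:R :> R by rewrite ltr0n; lia.
rewrite mulr_gt0 ?pi_gt0 ?divr_gt0 ?(ltr0n R k) //=.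
by rewrite -[ltRHS]mul1r ltr_pM2r ?pi_gt0 // ltr_pdivrMr // mul1r ltr_nat.
Qed.

Lemma cis_npi n : cis (n%:R * pi) = ((-1) ^+ n)%:C.
Proof.
by rewrite -cisX /cis cospi sinpi rmorphXn.
Qed.

(** Here [t] is sin (x + y) / sin y: the line through 0 at angle [x] meets the line through 1 at
    angle [x + y] in [t cis x]. *)
Lemma line_cis (x y t : R) : sin y != 0 -> t = cos x + sin x * (cos y / sin y) ->
  t%:C * cis x - 1 = (sin x / sin y)%:C * (cis x * cis y).
Proof.
move=> sy ->; have := cos2Dsin2 x => e.
apply/eqP; rewrite eq_complex /=; apply/andP; split; apply/eqP; last by field.
rewrite -[X in _ - X]e; field => //.
Qed.

Lemma horner_Re (P : {poly R[i]}) : exists r : {poly R},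
  forall t, Re P.[t%:C] = r.[t].
Proof.
exists (\poly_(l < size P) Re P`_l) => t; rewrite horner_poly horner_coef.
have ReD : {morph @Re R : x y / x + y} by move=> [? ?] [].
rewrite (big_morph (@Re R) ReD (erefl : Re 0 = 0)).
apply: eq_bigr => l _; rewrite -rmorphXn /=.
by case: P`_l => a b /=; ring.
Qed.

(** For c = 1 + iy, Re (c (a + ib)) = a - yb vanishes with b nonzero only if y = a / b; the chosen
    [y] exceeds all these ratios. *)
Lemma generic_direction (s : seq R[i]) : exists c : R[i],
  forall x, x \in s -> x != 0 -> Re (c * x) != 0.
Proof.
pose y := 1 + \sum_(x <- s) `|Re x / Im x|.
exists (1 +i* y) => x xs x0.
have yx : Re x / Im x < y.
  rewrite /y (big_rem x) //=; have := ler_norm (Re x / Im x).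
  have : 0 <= \sum_(z <- rem x s) `|Re z / Im z| by apply: sumr_ge0.
  lra.
move: x0 yx; case: {xs} x => a b; rewrite eq_complex /=.
have [-> /= /[!andbT] a0 _|b0 _] := eqVneq b 0; first by rewrite mul1r mulr0 subr0.
move=> /lt_eqF/negbT; apply: contra; rewrite mul1r subr_eq0 => /eqP ->.
by rewrite mulfK.
Qed.

(** One plus the sum of all ratios [|B i| / |A i|] exceeds each of them. *)
Lemma dominating_scale (I : finType) (A B : I -> R) :
  (forall i, A i != 0) -> exists2 K, 0 < K & forall i, `|B i| < K * `|A i|.
Proof.
move=> A0; pose K := 1 + \sum_i `|B i| / `|A i|.
have ge0 (P : pred I) : 0 <= \sum_(i | P i) `|B i| / `|A i|.
  by apply: sumr_ge0 => i _; rewrite divr_ge0.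
exists K => [|i]; first by have := ge0 predT; rewrite /K; lra.
rewrite -ltr_pdivrMr ?normr_gt0 // /K (bigD1 i) //=.
by have := ge0 (fun j => j != i); lra.
Qed.

Lemma sign_dominated (e f a b : R) :
  `|e| < `|a| -> `|f| < `|b| -> a * b < 0 -> (e + a) * (f + b) < 0.
Proof.
rewrite !ltr_norml => /andP[e1 e2] /andP[f1 f2] ab.
have [a0|a0] := ltP a 0.
  have b0 : 0 < b by nra.
  rewrite ltr0_norm // in e1 e2; rewrite gtr0_norm // in f1 f2; nra.
have b0 : b < 0 by nra.
rewrite ger0_norm // in e1 e2; rewrite ltr0_norm // in f1 f2; nra.
Qed.
End Lines.

(** * Many zeros on the lines *)

Section LowerBound.
Context {R : realType}.
Local Open Scope complex_scope.

Lemma cis_frac_piX (n k : nat) : (0 < n)%N ->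
  cis (k%:R / n%:R * pi : R) ^+ n = ((-1) ^+ k)%:C.
Proof.
move=> n0; rewrite cisX -cis_npi; congr cis; field.
by rewrite pnatr_eq0 -lt0n.
Qed.

Lemma Re_realM (a : R) (z : R[i]) : Re (a%:C * z) = a * Re z.
Proof. by case: z => u v /=; ring. Qed.

(** Q and its conjugate add up to 2 Re Q, and [w ^+ n] is real, so h is real on the line. A
    polynomial [G] makes the polynomial intermediate value theorem applicable. *)
Lemma harmonic_line (n : nat) (Q : {poly R[i]}) (w : R[i]) (e : R) :
  w ^+ n = e%:C -> exists G : {poly R}, forall t,
    G.[t] = e * t ^+ n + 2 * Re Q.[t%:C * w] /\
    harmonic_poly ('X^n + Q) Q (t%:C * w) = G.[t]%:C.
Proof.
move=> wn; have [r rE] := horner_Re (Q \Po (w *: 'X)).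
exists (e *: 'X^n + 2 *: r) => t.
have GE : (e *: 'X^n + 2 *: r).[t] = e * t ^+ n + 2 * Re Q.[t%:C * w].
  by rewrite !hornerE -rE horner_comp !hornerE [w * _]mulrC.
split=> //; rewrite GE /harmonic_poly !hornerE -addrA exprMn wn.
rewrite -[Num.conj _]/(conjc _) addcJ rmorphD !rmorphM rmorphXn rmorph_nat.
by rewrite mulrC.
Qed.

Lemma harmonic_many_zeros (n m : nat) : (m < n)%N ->
  exists p q : {poly R[i]}, [/\ size p = n.+1, size q = m.+1 &
    exists s : seq R[i], [/\ uniq s, size s = (n.-1 * (m - 2))%N &
      forall z, z \in s -> harmonic_zeros p q z]].
Proof.
move=> mn.
(* The shifts [k.+1] and [j.+1] skip the angle 0, so that all sines below are positive. *)
pose x (k : 'I_n.-1) : R := k.+1%:R / n%:R * pi.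
pose y (j : nat) : R := j.+1%:R / m%:R * pi.
have x_itv k : 0 < x k < pi by apply: frac_pi; have := ltn_ord k; lia.
have y_itv j : (j < m.-1)%N -> 0 < y j < pi by move=> jm; apply: frac_pi; lia.
have sx k : 0 < sin (x k) by exact: sin_gt0_pi.
have sy j : (j < m.-1)%N -> 0 < sin (y j) by move=> /y_itv; exact: sin_gt0_pi.
(* Parameter of the point where [t w - 1] is a positive multiple of [w * cis (y j)], with
   [w = cis (x k)]. *)
pose t k j : R := cos (x k) + sin (x k) * (cos (y j) / sin (y j)).
have t_decr k i j : (i < j < m.-1)%N -> t k j < t k i.
  move=> /andP[ij jm]; rewrite ltrD2l ltr_pM2l //.
  have im : (i < m.-1)%N by lia.
  have /andP[yi _] := y_itv i im; have /andP[_ yj] := y_itv j jm.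
  apply: cot_decr => //; rewrite ltr_pM2r ?pi_gt0 // ltr_pM2r ?ltr_nat //.
  by rewrite invr_gt0 ltr0n; lia.
(* The entry 1 gives Re c nonzero, hence h(0) nonzero; the others make the second term nonzero at
   every [t k j]. *)
have [c cP] := generic_direction (1 :: [seq cis (x k) ^+ m | k : 'I_n.-1]).
have cRe : Re c != 0 by have := cP 1; rewrite mulr1 mem_head oner_eq0 => ->.
have c0 : c != 0 by apply: contra_neq cRe => ->.
pose rho k := Re (c * cis (x k) ^+ m).
have rho0 k : rho k != 0.
  apply: cP; first by rewrite inE; apply/orP; right; apply/mapP; exists k; rewrite ?mem_enum.
  rewrite expf_eq0 negb_and; apply/orP; right; rewrite eq_complex /=.
  by rewrite negb_and (gt_eqF (sx k)) orbT.
(* The second term of [G] at [t k j], without its factor [K]; a single [K] then serves all lines and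
   points. *)
pose A (kj : 'I_n.-1 * 'I_m.-1) : R :=
  2 * ((sin (x kj.1) / sin (y kj.2)) ^+ m * (-1) ^+ kj.2.+1 * rho kj.1).
have A0 kj : A kj != 0.
  rewrite /A !mulf_neq0 ?expf_neq0 ?invr_neq0 ?oppr_eq0 ?oner_eq0 ?pnatr_eq0 //;
    by apply/negbT/gt_eqF; rewrite ?divr_gt0 ?sx ?sy.
have [K K0 KP] := dominating_scale 
  (fun kj : 'I_n.-1 * 'I_m.-1 => (-1) ^+ kj.1.+1 * t kj.1 kj.2 ^+ n) A0.
pose Q := (K%:C * c) *: ('X - 1) ^+ m : {poly R[i]}.
have Kc0 : K%:C * c != 0.
  by rewrite mulf_neq0 // eq_complex /= eqxx andbT gt_eqF.
have QE v : Q.[v] = K%:C * c * (v - 1) ^+ m by rewrite !hornerE.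
have sQ : size Q = m.+1 by rewrite size_scale // -polyC1 size_exp_XsubC.
exists ('X^n + Q), Q; split=> //.
  by rewrite size_polyDl ?size_polyXn ?sQ.
have line k : exists G : {poly R}, [/\
    forall r, harmonic_poly ('X^n + Q) Q (r%:C * cis (x k)) = G.[r]%:C,
    G.[0] != 0 &
    forall j : 'I_m.-1, G.[t k j] = (-1) ^+ k.+1 * t k j ^+ n + K * A (k, j)].
  have wn : cis (x k) ^+ n = ((-1) ^+ k.+1)%:C by apply: cis_frac_piX; lia.
  have [G GE] := harmonic_line Q wn.
  exists G; split=> [r||j]; first by have [] := GE r.
    have [-> _] := GE 0; rewrite expr0n gtn_eqF ?(leq_ltn_trans _ mn) // mulr0 add0r.
    have -> : Q.[0%:C * cis (x k)] = (K * (-1) ^+ m)%:C * c.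
      by rewrite rmorph0 mul0r QE sub0r rmorphM rmorphXn rmorphN1 mulrAC.
    by rewrite Re_realM !mulf_neq0 ?expf_neq0 ?oppr_eq0 ?oner_eq0 ?pnatr_eq0 ?(lt0r_neq0 K0).
  have [-> _] := GE (t k j); congr (_ + _).
  have ym : cis (y j) ^+ m = ((-1) ^+ j.+1)%:C.
    by apply: cis_frac_piX; have := ltn_ord j; lia.
  have -> : Q.[(t k j)%:C * cis (x k)] =
      (K * (sin (x k) / sin (y j)) ^+ m * (-1) ^+ j.+1)%:C * (c * cis (x k) ^+ m).
    rewrite QE (line_cis (y := y j) _ (erefl _)) ?gt_eqF ?sy //.
    move: (_ / _) (cis (x k)) ym => a w ym; rewrite !exprMn ym.
    rewrite [in RHS](_ : _%:C = K%:C * a%:C ^+ m * ((-1) ^+ j.+1)%:C); first by ring.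
    by rewrite !rmorphM rmorphXn.
  rewrite Re_realM /A /= -/(rho k); ring.
have /choice[G GP] := line.
have A_alt k (i j : 'I_m.-1) : j = i.+1 :> nat -> K * A (k, j) * (K * A (k, i)) < 0.
  move=> ji; rewrite -oppr_gt0.
  (* Consecutive signs differ by one factor -1, so the negated product is a nonzero square times a
     positive number. *)
  rewrite (_ : - _ = (2 * K * rho k * (-1) ^+ i.+1) ^+ 2 *
    ((sin (x k) / sin (y j)) ^+ m * (sin (x k) / sin (y i)) ^+ m)).
    apply: mulr_gt0; last by rewrite mulr_gt0 ?exprn_gt0 ?divr_gt0 ?sx ?sy.
    rewrite exprn_even_gt0 //=.
    by rewrite !mulf_neq0 ?expf_neq0 ?oppr_eq0 ?oner_eq0 ?pnatr_eq0 ?(lt0r_neq0 K0).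
  by rewrite /A /= ji exprS; ring.
(* The [m.-1] sample points of a line bound [m - 2] consecutive intervals, each containing a
   root. *)
have roots (kj : 'I_n.-1 * 'I_(m - 2)) : exists r : R,
    t kj.1 kj.2.+1 < r < t kj.1 kj.2 /\ (G kj.1).[r] = 0.
  case: kj => k j /=; have ltj := ltn_ord j.
  have im : (j < m.-1)%N by lia.
  have jm : (j.+1 < m.-1)%N by lia.
  have [_ _ GA] := GP k.
  have le_t : t k j.+1 <= t k j by apply/ltW/t_decr; rewrite ltnSn.
  have [|r] := poly_ivtoo (p := G k) le_t.
  - rewrite (GA (Ordinal im)) (GA (Ordinal jm)).
    have Kn i : K * `|A (k, i)| = `|K * A (k, i)| by rewrite [RHS]normrM (gtr0_norm K0).
    apply: sign_dominated; rewrite -?Kn ?(KP (k, _)) //.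
    exact: A_alt.
  - by rewrite in_itv => rI /rootP Gr; exists r.
have /choice[r rP] := roots.
pose z kj := (r kj)%:C * cis (x kj.1).
have z_inj : injective z.
  move=> [k j] [k' j'] zz.
  have [/andP[lo hi] rG] := rP (k, j); have [/andP[lo' hi'] _] := rP (k', j').
  have [_ G0 _] := GP k.
  have r0 : r (k, j) != 0 by apply: contra_eq_neq rG => /= ->.
  have [/= zRe zIm] : Re (z (k, j)) = Re (z (k', j')) /\ Im (z (k, j)) = Im (z (k', j')).
    by rewrite zz.
  rewrite !mul0r !subr0 in zRe; rewrite !mul0r !addr0 in zIm.
  (* Equal nonzero points have parallel directions; angles in (0, pi) then coincide. On one line,
     the open intervals are disjoint. *)
  have s0 : sin (x k - x k') = 0.
    by apply: (mulfI r0); rewrite mulr0 sinB mulrBr !mulrA zIm zRe; ring.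
  have xx : x k = x k'.
    have /andP[? ?] := x_itv k; have /andP[? ?] := x_itv k'.
    by apply/eqP; rewrite -subr_eq0 (sin_eq0_ltpi s0) // ltr_norml; apply/andP; split; lra.
  have kk : k = k'.
    apply/val_inj/succn_inj/eqP; rewrite -(eqr_nat R); apply/eqP.
    move: xx; rewrite /x => /(mulIf (lt0r_neq0 (pi_gt0 R)))/mulIf; apply.
    by rewrite invr_eq0 pnatr_eq0; lia.
  subst k'; congr pair.
  have rr : r (k, j) = r (k, j') by apply: (mulIf (lt0r_neq0 (sx k))).
  rewrite -rr /= in lo' hi'; rewrite /= in lo hi.
  have t_le i i' : (i <= i' < m.-1)%N -> t k i' <= t k i.
    move=> /andP[]; rewrite leq_eqVlt => /predU1P[-> //|ii i'm].
    by apply/ltW/t_decr; rewrite ii.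
  have ltj := ltn_ord j; have ltj' := ltn_ord j'.
  apply/val_inj; have [jj|jj|//] := ltngtP j j'.
  - have tt : t k j' <= t k j.+1 by apply: t_le; lia.
    by have := lt_trans (lt_le_trans hi' tt) lo; rewrite ltxx.
  - have tt : t k j <= t k j'.+1 by apply: t_le; lia.
    by have := lt_trans (lt_le_trans hi tt) lo'; rewrite ltxx.
exists [seq z kj | kj : 'I_n.-1 * 'I_(m - 2)]; split.
- by rewrite map_inj_uniq ?enum_uniq.
- by rewrite size_map -cardE card_prod !card_ord.
- move=> _ /mapP[kj _ ->]; have [+ _ _] := GP kj.1; have [_ rG] := rP kj.
  by rewrite /harmonic_zeros /= => ->; rewrite rG.
Qed.
End LowerBound.

(** * The maximum exists and satisfies both bounds *)

Section MaxZeros.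
Context {R : realType}.
Implicit Types p q : {poly R[i]}.

Lemma card_harmonic_zeros p q n m :
  (m < n)%N -> size p = n.+1 -> size q = m.+1 ->
  exists2 k, (k <= n ^ 2)%N & harmonic_zeros p q #= `I_k.
Proof.
move=> mn sp sq; set Z := harmonic_zeros p q.
have bound (B : {fset R[i]}) : [set` B] `<=` Z -> (#|` B| <= n ^ 2)%N.
  by move=> BZ; apply: (size_harmonic_zeros mn sp sq (fset_uniq B)) => z /BZ.
have [/finite_fsetP[B ZB]|/infinite_set_fset infZ] := pselect (finite_set Z).
  exists #|` B|; first by apply: bound; rewrite ZB.
  by rewrite ZB; apply/card_eq_fsetP.
(* An infinite zero set would contain more than n^2 points. *)
by have [B /bound leB] := infZ (n ^ 2).+1; rewrite ltnNge leB.
Qed.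

Lemma max_zerosP n m : (m < n)%N -> is_max_zeros R n m (max_zeros R n m).
Proof.
move=> mn; rewrite /max_zeros; case: xgetP => [N _ //|none].
pose P k := `[< exists p q, [/\ size p = n.+1, size q = m.+1 &
  harmonic_zeros p q #= `I_k] >].
have exP : exists k, P k.
  (* This only supplies some pair with the right degrees, so that the bounded set of attained counts
     is nonempty. *)
  have [p [q [sp sq _]]] := harmonic_many_zeros (R := R) mn.
  have [k _ Zk] := card_harmonic_zeros mn sp sq.
  by exists k; apply/asboolP; exists p, q.
have ubP k : P k -> (k <= n ^ 2)%N.
  move=> /asboolP[p [q [sp sq Zk]]].
  have [l ln Zl] := card_harmonic_zeros mn sp sq.
  by rewrite -card_le_II -(card_le_eql Zk) (card_le_eql Zl) card_le_II.
have [N /asboolP PN Nmax] := ex_maxnP exP ubP.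
case: (none N); split=> // p q sp sq.
have [k _ Zk] := card_harmonic_zeros mn sp sq.
rewrite (card_le_eql Zk) card_le_II; apply: Nmax.
by apply/asboolP; exists p, q.
Qed.

Lemma max_zeros_le n m : (m < n)%N -> (max_zeros R n m <= n ^ 2)%N.
Proof.
move=> mn; have [[p [q [sp sq ZN]]] _] := max_zerosP mn.
have [k kn Zk] := card_harmonic_zeros mn sp sq.
by rewrite -card_le_II -(card_le_eql ZN) (card_le_eql Zk) card_le_II.
Qed.

Lemma max_zeros_ge n m : (m < n)%N -> (n.-1 * (m - 2) <= max_zeros R n m)%N.
Proof.
move=> mn; have [_ Nmax] := max_zerosP mn.
have [p [q [sp sq [s [us <- sZ]]]]] := harmonic_many_zeros (R := R) mn.
rewrite -card_le_II; apply: card_le_trans (Nmax p q sp sq).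
have sI : [set` [fset z in s]%fset] #= `I_(size s).
  by apply/card_eq_fsetP; rewrite card_fseq undup_id.
rewrite -(card_le_eql sI); apply: subset_card_le => z /=.
by rewrite inE /=; apply: sZ.
Qed.
End MaxZeros.

(** * Passage to the upper limit *)

Section Limsup.
Context {R : realType}.
Implicit Types (u : nat -> R) (a : R).

(** The upper limit is an infimum of suprema over sets of the filter; each such set meets the one
    where [a - e <= u n]. *)
Lemma limn_esup_ge u a :
  (forall e, 0 < e -> \forall n \near \oo, a - e <= u n) ->
  (a%:E <= limn_esup (fun n => (u n)%:E))%E.
Proof.
move=> au; apply: le_ereal_inf_tmp => _ [A Aoo <-].
apply/lee_addgt0Pr => e e0.
have [n [An aun]] : exists n, A n /\ a - e <= u n.
  exact: (@filter_ex _ \oo _ _ (filterI Aoo (au e e0))).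
apply: (@le_trans _ _ ((u n)%:E + e%:E)%E).
  by rewrite -EFinD lee_fin -lerBlDr.
by apply: leeD => //; apply: ereal_sup_ubound; exists n.
Qed.

Lemma limn_esup_le u a :
  (\forall n \near \oo, u n <= a) -> (limn_esup (fun n => (u n)%:E) <= a%:E)%E.
Proof.
move=> ua; pose A : set nat := [set n | u n <= a].
apply: (@le_trans _ _ (ereal_sup ((fun n => (u n)%:E) @` A))).
  by apply: ereal_inf_lbound; exists A.
by apply: ge_ereal_sup => _ [n An <-]; rewrite lee_fin.
Qed.

Lemma limn_esup_max_zeros_ge (m : nat -> nat) (alpha : R) :
  (forall n, (0 < n)%N -> (m n < n)%N) -> 0 <= alpha <= 1 ->
  (forall e, 0 < e -> \forall n \near \oo,
     `|(m n)%:R - alpha * n%:R| <= e * n%:R) ->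
  ((alpha ^+ 2)%:E <=
     limn_esup (fun n => ((max_zeros R n (m n))%:R / n%:R ^+ 2)%:E))%E.
Proof.
move=> mn /andP[a0 a1] ma; apply: limn_esup_ge => e e0.
(* Half of [e] pays for the deviation of [m n] from [alpha * n], the other half for the linear loss
   [3 * n], whence [6 / e <= n]. *)
have e20 : 0 < e / 2 by lra.
near=> n.
have n0 : (0 < n)%N by near: n; exists 1%N.
have nR : 0 < n%:R :> R by rewrite ltr0n.
have : `|(m n)%:R - alpha * n%:R| <= e / 2 * n%:R by near: n; exact: ma.
rewrite ler_norml => /andP[ma_n _].
have en : 6 / e <= n%:R by near: n; exact: nbhs_infty_ger.
rewrite ler_pdivlMr ?exprn_gt0 //.
have := max_zeros_ge (R := R) (mn n n0); rewrite -(ler_nat R); apply: le_trans.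
have mn1 : (m n)%:R <= n%:R :> R by rewrite ler_nat ltnW ?mn.
have lower : n%:R * (m n)%:R - 3 * n%:R <= (n.-1 * (m n - 2))%:R :> R.
  have : (n * m n <= n.-1 * (m n - 2) + 3 * n)%N by have := mn n n0; nia.
  by rewrite -(ler_nat R) natrD !natrM; lra.
apply: le_trans lower.
rewrite ler_pdivrMr // in en.
have a2 : alpha ^+ 2 <= alpha by nra.
nra.
Unshelve. all: by end_near. Qed.
End Limsup.

Theorem corollary1 (R : realType) :
  (forall a : nat, (1 <= a)%N ->
     limn_esup (fun n : nat =>
       ((max_zeros R n (n - a))%:R / n%:R ^+ 2)%:E) = (1%:E : \bar R)) /\
  (forall (m : nat -> nat) (alpha : R),
     (forall n : nat, (0 < n)%N -> (m n < n)%N) ->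
     0 <= alpha <= 1 ->
     (fun n : nat => (m n)%:R : R^o) =
       (fun n : nat => alpha * n%:R : R^o) +o_ \oo (fun n : nat => n%:R : R^o) ->
     ((alpha ^+ 2)%:E <=
       limn_esup (fun n : nat =>
         ((max_zeros R n (m n))%:R / n%:R ^+ 2)%:E))%E).
Proof.
split=> [a a1|m alpha mn alpha01 /eqaddoP mo].
  apply/eqP; rewrite eq_le; apply/andP; split.
    apply: limn_esup_le; near=> n.
    have n0 : (0 < n)%N by near: n; exists 1%N.
    rewrite ler_pdivrMr ?exprn_gt0 ?ltr0n // mul1r -natrX ler_nat.
    by apply: max_zeros_le; lia.
  (* The case [alpha = 1]: the deviation is at most [a], hence at most [e * n] once [n] reaches
     [a / e]. *)
  have := @limn_esup_max_zeros_ge R (fun n => n - a)%N 1; rewrite expr1n.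
  apply=> [n n0||e e0].
  - by lia.
  - by rewrite ler01 lexx.
  - near=> n.
    have an : (a <= n)%N by near: n; exists a.
    rewrite natrB // mul1r addrAC subrr sub0r normrN ger0_norm // mulrC.
    by rewrite -ler_pdivrMr //; near: n; exact: nbhs_infty_ger.
apply: limn_esup_max_zeros_ge => // e e0.
have := mo e e0; apply: filterS => n /=.
by move=> mon; rewrite -[n%:R in leRHS](normr_nat R); exact: mon.
Unshelve. all: by end_near. Qed.
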